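(* Let $n\geq 0$ and $m\geq 3$ be integers, let $D=(\mathcal{M},A(D))$ be a digraph on the $m$ vertices $\mathcal{M}=\{1,\ldots,m\}$, and let $u=u_n\ldots u_1$ and $v=v_n\ldots v_1$ be vertices of the restricted Hanoi graph $H_n^m(D)$. Then $(u,v)\in A(H_n^m(D))$ only if there exists a unique $k\in\mathcal{N}=\{1,\ldots,n\}$ such that the following conditions are fulfilled: 1. $u_k\neq v_k$ and $u_d=v_d$ for all $d\in\mathcal{N}\setminus\{k\}$; 2. $u_d\neq u_k$ for all $d<k$; 3. $v_d\neq v_k$ for all $d<k$; 4. $(u_k,v_k)\in A(D)$.
   Context: Let $\mathcal{N}=\{1,\ldots,n\}$ be the set of discs (disc $d$ is smaller than disc $d'$ when $d<d'$) and $\mathcal{M}=\{1,\ldots,m\}$ the set of pegs. A movement digraph is a digraph $D=(\mathcal{M},A(D))$ (no loops, no multiple arcs), where $(p,q)\in A(D)$ means that moving a disc from peg $p$ to peg $q$ is allowed. The restricted Hanoi graph $H_n^m(D)$ is the digraph whose vertices are all the distributions of the $n$ discs on the $m$ pegs, each written as an $n$-tuple $u=u_n\ldots u_1$ with $u_d\in\mathcal{M}$ the peg on which disc $d$ lies (on each peg the discs are stacked with smaller discs above larger ones). There is an arc $(u,v)\in A(H_n^m(D))$ if and only if $v$ is obtained from $u$ by one legal move, i.e. a move obeying: (i) exactly one disc is moved, from its peg to a different one; (ii) the disc moved is the topmost disc of its peg; (iii) a disc cannot be placed on a smaller one; and the disc is moved from a peg $p$ to a peg $q$ with $(p,q)\in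 A(D)$. *)

(* Defs.v *)
From mathcomp Require Import all_boot.
Set Implicit Arguments.
Unset Strict Implicit.
Unset Printing Implicit Defensive.

Record digraph (V : finType) := Digraph {
  has_arc : rel V;
  has_arc_irrefl : irreflexive has_arc
}.

(* Discs and pegs are numbered from 0: the ordinal d : 'I_n is disc d + 1, and
   disc d is smaller than disc e exactly when d < e.  The vertex u_n ... u_1 is
   the finite function mapping each disc to the peg on which it lies. *)
Definition config (n m : nat) := {ffun 'I_n -> 'I_m}.

Section HanoiGraph.

Variables (n m : nat) (D : digraph 'I_m).
Implicit Types (u v : config n m) (d e : 'I_n) (p q : 'I_m).

(* Listed from top to bottom: enum 'I_n is increasing, and smaller discs lie
   above larger ones. *)
Definition stack u p : seq 'I_n := [seq d <- enum 'I_n | u d == p].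

Definition top_disc u p : option 'I_n := ohead (stack u p).

Definition move_disc u d q : config n m :=
  [ffun e => if e == d then q else u e].

Definition legal_move u d q : bool :=
  [&& q != u d,
      top_disc u (u d) == Some d,
      (if top_disc u q is Some e then ~~ (e < d) else true)
    & has_arc D (u d) q].

Definition hanoi_arc : rel (config n m) :=
  fun u v => [exists d, exists q, legal_move u d q && (v == move_disc u d q)].

Lemma hanoi_arc_irrefl : irreflexive hanoi_arc.
Proof.
move=> u; apply/existsP=> -[d /existsP[q /andP[/and4P[qNud _ _ _] /eqP uE]]].
by move: qNud; rewrite {1}uE ffunE eqxx eqxx.
Qed.

Definition hanoi_graph : digraph (config n m) := Digraph hanoi_arc_irrefl.

End HanoiGraph.

Arguments hanoi_graph n {m} D.

(* Main.v *)
Require Import Defs.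
From mathcomp Require Import all_boot.
Set Implicit Arguments.
Unset Strict Implicit.
Unset Printing Implicit Defensive.

(** The disc [k] that is moved is the required one.  Since the top disc of a
    peg is the smallest disc on it ([top_disc_min]), every disc smaller than [k]
    is off the source peg because [k] is on top there, and off the target peg
    because the top disc of the target peg is not smaller than [k].  Those
    smaller discs do not move, so the second fact holds after the move as well
    as before it.  Uniqueness needs the first condition only: [k] is the one
    disc at which the two configurations differ. *)

Lemma stack_sorted (n m : nat) (u : config n m) (p : 'I_m) :
  sorted (relpre val leq) (stack u p).
Proof.
apply: sorted_filter; first by move=> y x z; apply: leq_trans.
by rewrite -sorted_map val_enum_ord iota_sorted.
Qed.

(** Stating existence together with minimality makes an empty target peg need
    no case of its own: a disc lying there already provides a top disc. *)
Lemma top_disc_min (n m : nat) (u : config n m) (d : 'I_n) :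
  exists2 t : 'I_n, top_disc u (u d) = Some t & t <= d.
Proof.
have d_in : d \in stack u (u d) by rewrite mem_filter eqxx mem_enum.
rewrite /top_disc; case: (stack u (u d)) d_in (stack_sorted u (u d)) => //= t s.
rewrite inE => /predU1P[-> _ | d_in]; first by exists t.
rewrite path_sortedE; last by move=> y x z; apply: leq_trans.
by case/andP=> /allP/(_ d d_in) /= le_td _; exists t.
Qed.

Lemma legal_move_source (n m : nat) (D : digraph 'I_m) (u : config n m)
    (k d : 'I_n) (q : 'I_m) :
  legal_move D u k q -> d < k -> u d <> u k.
Proof.
case/and4P=> _ /eqP top_k _ _ lt_dk eq_dk; have [t] := top_disc_min u d.
by rewrite eq_dk top_k => -[<-]; rewrite leqNgt lt_dk.
Qed.

Lemma legal_move_target (n m : nat) (D : digraph 'I_m) (u : config n m)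
    (k d : 'I_n) (q : 'I_m) :
  legal_move D u k q -> d < k -> u d <> q.
Proof.
case/and4P=> _ _ + _ lt_dk eq_dq; have [t] := top_disc_min u d.
by rewrite eq_dq => -> le_td; rewrite (leq_ltn_trans le_td lt_dk).
Qed.

Theorem theorem1 (n m : nat) (hm : 3 <= m) (D : digraph 'I_m)
    (u v : config n m) :
  has_arc (hanoi_graph n D) u v ->
  exists! k : 'I_n,
    [/\ u k <> v k /\ (forall d : 'I_n, d <> k -> u d = v d),
        forall d : 'I_n, d < k -> u d <> u k,
        forall d : 'I_n, d < k -> v d <> v k
      & has_arc D (u k) (v k)].
Proof.
case/existsP=> k /existsP[q /andP[move_kq /eqP v_eq]].
have [/eqP q_neq _ _ arc_kq] := and4P move_kq.
have vk : v k = q by rewrite v_eq ffunE eqxx.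
have vd d : d <> k -> v d = u d by move=> /eqP/negPf d_k; rewrite v_eq ffunE d_k.
exists k; split; last first.
  move=> l [[l_neq _] _ _ _]; case: (k =P l) => // k_neq.
  by case: l_neq; rewrite vd // => /esym.
split; rewrite ?vk //.
- by split=> [/esym // | d /vd].
- by move=> d; apply: legal_move_source move_kq.
- move=> d lt_dk; rewrite vd; first exact: legal_move_target move_kq lt_dk.
  by move=> eq_dk; rewrite eq_dk ltnn in lt_dk.
Qed.
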